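(* Let $G$ be a totally disconnected, locally compact group. Then every RIO subgroup of $G$ is an RRS subgroup of $G$.
   Context: All topological groups are Hausdorff. A group is compactly generated if it is generated by a compact subset. A closed subgroup $H$ of $G$ is a RIO subgroup of $G$ if every compactly generated open subgroup of $H$ is an intersection of open subgroups of $G$. A closed subgroup $H$ of $G$ is regionally relatively separable (RRS) in $G$ if for every compactly generated open subgroup $K$ of $H$, there is an open subgroup $O$ of $G$ such that $K = H\cap O$. *)

(* Defs.v *)
From HB Require Import structures.
From mathcomp Require Import all_boot all_classical topology.

Set Implicit Arguments.
Unset Strict Implicit.
Unset Printing Implicit Defensive.

Import Algebra.

Local Open Scope classical_set_scope.
Local Open Scope group_scope.

(* Continuity of multiplication is joint, for the product topology on G * G.
   The Hausdorff axiom is not part of this structure and is assumed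
   separately. *)
HB.mixin Record isTopologicalGroup G of Group G & Topological G := {
  mulg_continuous : continuous (fun z : G * G => z.1 * z.2) ;
  invg_continuous : continuous (fun x : G => x^-1)
}.

#[short(type="topologicalGroupType")]
HB.structure Definition TopologicalGroup :=
  {G of Group G & Topological G & isTopologicalGroup G}.

Definition subgroup (G : groupType) (A : set G) : Prop := group_closed [in A].

Definition generated_subgroup (G : groupType) (C : set G) : set G :=
  smallest (@subgroup G) C.

Lemma subgroupP (G : groupType) (A : set G) :
  subgroup A <-> [/\ A 1, (forall x y, A x -> A y -> A (x * y))
                   & (forall x, A x -> A x^-1)].
Proof.
split=> [[A1 AV]|[A1 AM AV]].
  have {A1 AV}[A1 AF] : A 1 /\ forall x y, A x -> A y -> A (x / y).
    split=> [|x y Ax Ay]; first by move: A1; rewrite !inE.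
    have: x / y \in [in A] by apply: AV; rewrite !inE.
    by rewrite !inE.
  have AV x : A x -> A x^-1 by move=> Ax; rewrite -[x^-1]mul1g; exact: AF.
  split=> // x y Ax Ay; rewrite -[y]invgK; apply: AF => //; exact: AV.
split=> [|x y]; rewrite !inE // => Ax Ay; apply: AM => //; exact: AV.
Qed.

Section TopologicalGroupSubsets.
Variable G : topologicalGroupType.
Implicit Types H K O : set G.

(* A compact subset of a subgroup K, for the topology of K, is the same thing
   as a compact subset of G contained in K; the inclusion C `<=` K follows from
   K = generated_subgroup C. *)
Definition compactly_generated K : Prop :=
  exists2 C : set G, compact C & K = generated_subgroup C.

Definition open_subgroup O : Prop := subgroup O /\ open O.

Definition closed_subgroup H : Prop := subgroup H /\ closed H.

(* In subspace H the points outside H are isolated, so openness there is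
   openness relative to H only in the presence of K `<=` H. *)
Definition open_subgroup_of H K : Prop :=
  [/\ subgroup K, K `<=` H & open (K : set (subspace H))].

Definition RIO_subgroup H : Prop :=
  closed_subgroup H /\
  forall K, open_subgroup_of H K -> compactly_generated K ->
    exists2 F : set (set G),
      F `<=` [set O | open_subgroup O] & K = \bigcap_(O in F) O.

Definition RRS_subgroup H : Prop :=
  closed_subgroup H /\
  forall K, open_subgroup_of H K -> compactly_generated K ->
    exists2 O : set G, open_subgroup O & K = H `&` O.

End TopologicalGroupSubsets.

(* Main.v *)
(** By van Dantzig's theorem there is a compact open subgroup U of G such that
    H ∩ U is contained in K.  Let the compact set C generate K.  The open
    subgroups containing K form a family of closed sets, directed downwards,
    with intersection K; since U(C ∪ C^-1) is compact and KU is an open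
    neighbourhood of K, some open subgroup O containing K satisfies
    O ∩ U(C ∪ C^-1) ⊆ KU.  With V = O ∩ U this gives VC, VC^-1 ⊆ KV, hence
    VK ⊆ KV, so that KV is an open subgroup, and
    H ∩ KV = K(H ∩ V) = K. *)
Require Import Defs.
From mathcomp Require Import all_boot all_classical topology.

Set Implicit Arguments.
Unset Strict Implicit.
Unset Printing Implicit Defensive.

Import Algebra.

Local Open Scope classical_set_scope.

(** * Compact open neighbourhoods in totally disconnected locally compact spaces *)

Section Topology.
Context {T : topologicalType}.
Implicit Types (x : T) (A C K W : set T).

(** Otherwise the sets [K] ∩ [A] \ [W], for [A] in [F], form the base of a proper filter on [K]. By
    closedness a cluster point lies in every [A], hence in [W], but also in the closed complement of
    [W]. *)
Lemma compact_bigcap_open (F : set (set T)) K W :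
  compact K -> open W -> F !=set0 -> (forall A, F A -> closed A) ->
  (forall A B, F A -> F B -> F (A `&` B)) ->
  K `&` \bigcap_(A in F) A `<=` W -> exists2 A, F A & K `&` A `<=` W.
Proof.
move=> cK oW [A0 FA0] Fc FI KFW; apply: contrapT => noA.
pose B A := K `&` A `&` ~` W.
have ne A : F A -> B A !=set0.
  move=> FA; apply/set0P/eqP => BA0; apply: noA; exists A => // z KAz.
  by apply: contrapT => Wz; have : B A z by []; rewrite BA0.
have PF : ProperFilter (filter_from F B).
  apply: filter_from_proper => //; apply: filter_from_filter; first by exists A0.
  by move=> A1 A2 F1 F2; exists (A1 `&` A2);
    [exact: FI|move=> z [[Kz [? ?]] Wz]].
have [|p [Kp clp]] := cK _ PF; first by exists A0 => // z [[]].
have clB A : F A -> closure (B A) p.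
  by move=> FA V Vp; apply: clp => //; exists A.
have : W p.
  apply: KFW; split=> // A FA; apply: (Fc _ FA).
  by apply: closureS (clB _ FA) => z [[]].
have : closed (~` W) by exact: open_closedC.
by apply; apply: closureS (clB _ FA0) => z [].
Qed.

(** For closed [C] these are the clopen subsets of the subspace [C], expressed through closed sets
    of [T]. *)
Definition relatively_clopen C : set (set T) :=
  [set A | [/\ A `<=` C, closed A & closed (C `\` A)]].

Definition quasi_component C x : set T :=
  \bigcap_(A in [set A | relatively_clopen C A /\ A x]) A.

Lemma quasi_component_sub C x : closed C -> C x -> quasi_component C x `<=` C.
Proof.
by move=> cC Cx z; apply; split=> //; split=> //; rewrite setDv; exact: closed0.
Qed.

Lemma relatively_clopenI C A B :
  relatively_clopen C A -> relatively_clopen C B -> relatively_clopen C (A `&` B).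
Proof.
move=> [AC cA cA'] [BC cB cB']; split; first by move=> z [/AC].
- exact: closedI.
- by rewrite setDIr; exact: closedU.
Qed.

Lemma quasi_component_nbhs C x W : compact C -> closed C -> C x -> open W ->
  quasi_component C x `<=` W ->
  exists A, [/\ relatively_clopen C A, A x & A `<=` W].
Proof.
move=> kC cC Cx oW QW.
pose F := [set A | relatively_clopen C A /\ A x].
have [||||A [rA Ax] AW] := @compact_bigcap_open F _ _ kC oW.
- by exists C; split=> //; split=> //; rewrite setDv; exact: closed0.
- by move=> A [[]].
- by move=> A B [rA Ax] [rB Bx]; split=> //; exact: relatively_clopenI.
- by move=> z [_ Qz]; apply: QW.
exists A; split=> // z Az; apply: AW; split=> //; by case: rA => + _ _; exact.
Qed.

(** A splitting of the quasi-component into two closed pieces extends to disjoint open sets [U] and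
    [U']. A relatively clopen neighbourhood of [x] inside their union is cut by them into relatively
    clopen halves, and the half containing [x] contains the whole quasi-component, so the other
    piece is empty. The compact set [L] provides the room for normality. *)
Lemma quasi_component_connected L C x : hausdorff_space T -> compact L ->
  closed C -> C x -> C `<=` L° -> connected (quasi_component C x).
Proof.
move=> hT kL cC Cx CL; apply/connectedP => E [E0 QE [E1 E2]].
have CsubL : C `<=` L by apply: subset_trans CL _; exact: interior_subset.
have kC : compact C by exact: subclosed_compact cC kL CsubL.
set Q := quasi_component C x in QE.
have QC : Q `<=` C by exact: quasi_component_sub.
have cQ : closed Q by apply: closed_bigI => A [[]].
have cE b : closed (E b).
  have EQ : E b `<=` Q by rewrite QE => z; case: b => ?; [right|left].
  move=> z clz; have : Q z by apply: cQ; exact: closureS clz.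
  rewrite QE; case: b clz {EQ} => clz [] Ebz //.
  - by have : (E false `&` closure (E true)) z by []; rewrite E2.
  - by have : (closure (E false) `&` E true) z by []; rewrite E1.
have nE : set_nbhs (E false) (~` E true).
  apply/set_nbhsP; exists (~` E true); split=> //; first exact: closed_openC.
  by move=> z Fz Tz; have : (closure (E false) `&` E true) z;
    [split=> //; exact: subset_closure|rewrite E1].
have EL : E false `<=` L°.
  by apply: subset_trans CL; apply: subset_trans QC; rewrite QE => z; left.
have [V /set_nbhsP[U [oU EU UV]] clV] := compact_normal_local hT kL EL (cE _) nE.
pose U' := ~` closure V.
have oU' : open U' by apply: closed_openC; exact: closed_closure.
have dis z : U z -> U' z -> False by move=> /UV Vz; apply; exact: subset_closure.
have QU : Q `<=` U `|` U'.
  by rewrite QE => z [/EU|Tz]; [left|right => /clV].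
have [A [[AC cA cCA] Ax AU]] :=
  quasi_component_nbhs kC cC Cx (openU oU oU') QU.
(* Within [A], the set [O] is the complement of [O'], so [A] ∩ [O] is again relatively clopen in
   [C]. *)
have half O O' : open O -> open O' -> (forall z, O z -> O' z -> False) ->
    A `<=` O `|` O' -> O x -> Q `<=` O.
  move=> oO oO' OO' AO Ox z /(_ (A `&` O))[] //; split=> //; split.
  - by move=> y [/AC].
  - rewrite (_ : A `&` O = A `&` ~` O'); first exact: closedI (open_closedC _).
    apply/seteqP; split=> y [Ay Oy]; split=> //; first exact: OO'.
    by case: (AO _ Ay).
  - rewrite (_ : C `\` _ = (C `\` A) `|` (A `&` ~` O)).
      by apply: closedU => //; exact: closedI (open_closedC _).
    apply/seteqP; split=> y.
      move=> [Cy AOy]; have [Ay|Ay] := pselect (A y); last by left.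
      by right; split=> // Oy; exact: AOy.
    by case=> -[]; [move=> Cy Ay; split=> // -[]|move=> /AC Cy Oy; split=> // -[]].
have [Ux|Ux'] := AU _ Ax.
- have [z Ez] := E0 true; have Uz : U z.
    by apply: (half U U') => //; rewrite QE; right.
  by have /UV/subset_closure/clV := Uz.
- have [z Ez] := E0 false; apply: (dis z); first exact: EU.
  apply: (half U' U) => //; first by move=> y ? ?; exact: (dis y).
  + by rewrite setUC.
  + by rewrite QE; left.
Qed.

(** In a compact neighbourhood [D] of [x], the quasi-component of [x] is connected, hence reduced to
    [x]. So some relatively clopen set containing [x] lies in the interior of [D], which makes it
    open in [T]. *)
Lemma compact_open_nbhs x W : hausdorff_space T ->
    totally_disconnected [set: T] -> locally_compact [set: T] -> nbhs x W ->
  exists B, [/\ compact B, open B, B x & B `<=` W].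
Proof.
move=> hT tT lT Wx.
have [L Lx [kL cL]] : exists2 L, nbhs x L & compact L /\ closed L.
  have [L] := lT x I; rewrite withinET => Lx ?; by exists L.
have LWx : nbhs x (L° `&` W).
  by apply: filterI => //; exact: nbhs_interior.
have [C Cx clC] := compact_regular hT kL Lx LWx.
have [cD Dx] : closed (closure C) /\ nbhs x (closure C).
  by split; [exact: closed_closure|apply: filterS Cx; exact: subset_closure].
set D := closure C in cD Dx clC.
have DL : D `<=` L° by move=> z /clC[].
have kD : compact D.
  apply: subclosed_compact cD kL _; apply: subset_trans DL _.
  exact: interior_subset.
have Dxx := nbhs_singleton Dx.
have Qx : quasi_component D x `<=` D°.
  move=> z Qz; suff -> : z = x by exact: Dx.
  have : connected_component [set: T] x z.
    exists (quasi_component D x) => //; split=> //; first by move=> A [].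
    exact: quasi_component_connected cD Dxx DL.
  by rewrite tT.
have [A [[AD cA cDA] Ax AD']] :=
  quasi_component_nbhs kD cD Dxx (open_interior _) Qx.
exists A; split=> //.
- exact: subclosed_compact cA kD AD.
- rewrite (_ : A = D° `&` ~` (D `\` A)).
    by apply: openI; [exact: open_interior|exact: closed_openC].
  apply/seteqP; split=> z.
    by move=> Az; split; [exact: AD'|case].
  by move=> [/interior_subset Dz /not_andP[]// /contrapT].
- by move=> z /AD/clC[].
Qed.

End Topology.

(** * Topological groups, up to van Dantzig's theorem *)

Section TopologicalGroup.
Local Open Scope group_scope.
Context {G : topologicalGroupType}.
Implicit Types (x : G) (A B C K O U : set G).

Lemma mulgl_continuous x : continuous (fun y : G => x * y).
Proof.
move=> y; apply: (cvg_comp (fun y => (x, y)) _ _ (mulg_continuous (x, y))).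
by apply: cvg_pair; [exact: cvg_cst|exact: cvg_id].
Qed.

Lemma mulgr_continuous x : continuous (fun y : G => y * x).
Proof.
move=> y; apply: (cvg_comp (fun y => (y, x)) _ _ (mulg_continuous (y, x))).
by apply: cvg_pair; [exact: cvg_id|exact: cvg_cst].
Qed.

Lemma subgroup_nbhs1_open U : subgroup U -> nbhs 1 U -> open U.
Proof.
move=> /subgroupP[_ UM _] U1; rewrite openE => x Ux.
have : nbhs x [set y | U (x^-1 * y)].
  by apply: (mulgl_continuous (x := x^-1)); rewrite mulVg.
by apply: filterS => y /(UM _ _ Ux); rewrite mulVKg.
Qed.

Lemma open_subgroup_closed U : open_subgroup U -> closed U.
Proof.
move=> [/subgroupP[U1 UM UV] oU] x clUx.
have : nbhs x [set y | U (x^-1 * y)].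
  by apply: (mulgl_continuous (x := x^-1)); rewrite mulVg; exact: open_nbhs_nbhs.
move=> /clUx [y [Uy /= /UV]]; rewrite invgM invgK => /(UM _ _ Uy).
by rewrite mulVKg.
Qed.

Lemma open_subgroupI U O :
  open_subgroup U -> open_subgroup O -> open_subgroup (U `&` O).
Proof.
move=> [/subgroupP[U1 UM UV] oU] [/subgroupP[O1 OM OV] oO].
split; last exact: openI.
apply/subgroupP; split=> //.
- by move=> x y [Ux Ox] [Uy Oy]; split; [exact: UM|exact: OM].
- by move=> x [Ux Ox]; split; [exact: UV|exact: OV].
Qed.

Lemma open_mulset A U : open U -> open [set x * y | x in A & y in U].
Proof.
move=> oU.
rewrite (_ : image2 _ _ _ = \bigcup_(x in A) ((fun y => x^-1 * y) @^-1` U)).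
  by apply: bigcup_open => x _; move/continuousP: (mulgl_continuous (x := x^-1)); exact.
apply/seteqP; split=> z.
  by move=> [x Ax [y Uy <-]]; exists x => //=; rewrite mulKg.
by move=> [x Ax /= Uz]; exists x => //; exists (x^-1 * z); rewrite // mulVKg.
Qed.

Lemma compact_mulset A B : compact A -> compact B ->
  compact [set x * y | x in A & y in B].
Proof.
move=> kA kB.
rewrite (_ : image2 _ _ _ = (fun z : G * G => z.1 * z.2) @` (A `*` B)).
  apply: continuous_compact; last exact: compact_setX.
  by apply: continuous_subspaceT; exact: mulg_continuous.
apply/seteqP; split=> z.
  by move=> [x Ax [y By <-]]; exists (x, y).
by move=> [[x y] [/= Ax By] <-]; exists x => //; exists y.
Qed.

Lemma compact_invset A : compact A -> compact [set x^-1 | x in A].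
Proof.
move=> kA; apply: continuous_compact kA.
by apply: continuous_subspaceT; exact: invg_continuous.
Qed.

(* The elements [x] such that [B x] and [B x^-1] are contained in [B] form a
   subgroup, which is open by compactness of [B]. *)
Lemma compact_open_subgroup B : hausdorff_space G -> compact B -> open B ->
  B 1 -> exists U, [/\ open_subgroup U, compact U & U `<=` B].
Proof.
move=> hG kB oB B1.
pose N := [set x | forall b, B b -> B (b * x)].
pose U := [set x | N x /\ N x^-1].
have nN : nbhs 1 N.
  have /compact_near_coveringP ncB := kB.
  apply: (ncB G (nbhs 1) (fun x b => B (b * x))) => b Bb.
  by apply: (mulg_continuous (b, 1)); rewrite /= mulg1; exact: open_nbhs_nbhs.
have sU : subgroup U.
  apply/subgroupP; split.
  - by split=> b Bb; rewrite ?invg1 mulg1.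
  - move=> x y [Nx Nx'] [Ny Ny']; split=> b Bb.
      by rewrite mulgA; apply/Ny/Nx.
    by rewrite invgM mulgA; apply/Nx'/Ny'.
  - by move=> x [Nx Nx']; split; rewrite ?invgK.
have oU : open U.
  apply: subgroup_nbhs1_open => //; apply: filterI => //.
  by apply: (invg_continuous (1 : G)); rewrite /= invg1.
have UB : U `<=` B by move=> x [/(_ _ B1)]; rewrite mul1g.
exists U; split=> //.
by apply: subclosed_compact kB UB; exact: open_subgroup_closed.
Qed.

Lemma van_dantzig W : hausdorff_space G -> totally_disconnected [set: G] ->
    locally_compact [set: G] -> nbhs 1 W ->
  exists U, [/\ open_subgroup U, compact U & U `<=` W].
Proof.
move=> hG tG lG W1.
have [B [kB oB B1 BW]] := compact_open_nbhs hG tG lG W1.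
have [U [oU kU UB]] := compact_open_subgroup hG kB oB B1.
by exists U; split=> //; exact: subset_trans UB BW.
Qed.

(** * Open subgroups of the form KV *)

Lemma subgroup_generated C : subgroup (generated_subgroup C).
Proof.
apply/subgroupP; split=> [|x y Cx Cy|x Cx] A [sA CA];
  move/subgroupP: (sA) => [A1 AM AV] //.
- by apply: AM; [exact: Cx|exact: Cy].
- by apply: AV; exact: Cx.
Qed.

(** The [x] for which both [U]x[and]U[x^-1] lie in [KU] form a subgroup containing [C], hence [K].
    Thus UK ⊆ KU, which gives stability under products and inverses. *)
Lemma mulset_generated_subgroup C U (K := generated_subgroup C) :
    subgroup U ->
    (forall u c, U u -> C c \/ C c^-1 -> [set k * v | k in K & v in U] (u * c)) ->
  subgroup [set k * v | k in K & v in U].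
Proof.
move=> /subgroupP[U1 UM UV] UC.
have /subgroupP[K1 KM KV] : subgroup K by exact: subgroup_generated.
pose KU := [set k * v | k in K & v in U].
pose K' := [set x | forall u, U u -> KU (u * x) /\ KU (u * x^-1)].
have K'M x y :
    (forall u, U u -> KU (u * x)) -> (forall u, U u -> KU (u * y)) ->
    forall u, U u -> KU (u * (x * y)).
  move=> Ux Uy u /Ux [k Kk [v /Uy [k' Kk' [v' Uv' e'] e]]].
  by exists (k * k'); [exact: KM|exists v'; rewrite // -mulgA e' mulgA e mulgA].
have sK' : subgroup K'.
  apply/subgroupP; split=> [u Uu|x y K'x K'y u Uu|x K'x u Uu].
  - by rewrite invg1 mulg1; split; exists 1 => //; exists u; rewrite // mul1g.
  - rewrite invgM; split; apply: K'M => // v Uv;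
      by [case: (K'x _ Uv)|case: (K'y _ Uv)].
  - by rewrite invgK; case: (K'x _ Uu).
have KK' : K `<=` K'.
  move=> x; apply; split=> // c Cc u Uu.
  by split; apply: UC => //; [left|right; rewrite invgK].
apply/subgroupP; split.
- by exists 1 => //; exists 1; rewrite // mulg1.
- move=> _ _ [k Kk [u Uu <-]] [l Kl [v Uv <-]].
  have [[k' Kk' [u' Uu' e]] _] := KK' _ Kl _ Uu.
  exists (k * k'); first exact: KM.
  exists (u' * v); first exact: UM.
  by rewrite -mulgA [k' * _]mulgA e !mulgA.
- move=> _ [k Kk [u Uu <-]]; rewrite invgM.
  by have [] := KK' _ Kk _ (UV _ Uu).
Qed.

Lemma bigcap_open_subgroup_sub K U (F : set (set G)) :
    F `<=` [set O | open_subgroup O] -> K = \bigcap_(O in F) O ->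
    compactly_generated K -> open_subgroup U -> compact U ->
  exists O, [/\ open_subgroup O, K `<=` O &
                O `<=` [set k * u | k in K & u in U]].
Proof.
move=> Fo KF [C kC KC] oU kU.
pose S := [set u * c | u in U & c in C `|` [set c^-1 | c in C]].
have kS : compact S.
  by apply: compact_mulset => //; apply: compactU => //; exact: compact_invset.
(* Unlike [F], this family is stable under binary intersections, and it contains [setT] even when
   [F] is empty. Since it includes [F], its intersection is still [K]. *)
pose F' := [set O | open_subgroup O /\ K `<=` O].
have [sU opU] := oU.
have [||||O [oO KO] SO] := @compact_bigcap_open _ F' _ _ kS (open_mulset K opU).
- exists setT; split=> //; split; last exact: openT.
  exact/subgroupP.
- by move=> O [oO _]; exact: open_subgroup_closed.
- move=> O O' [oO KO] [oO' KO']; split; first exact: open_subgroupI.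
  by move=> z Kz; split; [exact: KO|exact: KO'].
- move=> z [_ F'z]; exists z; last first.
    by exists 1; rewrite ?mulg1 //; case/subgroupP: sU.
  rewrite KF => O FO; apply: F'z; split; first exact: Fo.
  by rewrite KF => y; exact.
have [sO opO] := oO; have /subgroupP[O1 OM OV] := sO.
have CK : C `<=` K by rewrite KC; exact: sub_gen_smallest.
have [sV opV] := open_subgroupI oO oU.
have /subgroupP[K1 _ KV] : subgroup K by rewrite KC; exact: subgroup_generated.
exists [set k * v | k in K & v in O `&` U]; split.
- split; last exact: open_mulset.
  rewrite KC; apply: mulset_generated_subgroup => // u c [Ou Uu] Cc.
  rewrite -KC.
  have Kc : K c by case: Cc => /CK // /KV; rewrite invgK.
  have Ouc : O (u * c) by apply: OM => //; exact: KO.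
  have [|k Kk [v Uv e]] := SO (u * c).
    split=> //; exists u => //; exists c => //.
    by case: Cc => Cc; [left|right; exists c^-1; rewrite ?invgK].
  exists k => //; exists v => //; split=> //.
  (* The factor [v] is only known to lie in [U]; it lies in [O] as well because [k], [u] and [c]
     do. *)
  rewrite (_ : v = k^-1 * (u * c)); last by rewrite -e mulKg.
  by apply: OM => //; apply: OV; exact: KO.
- move=> k Kk; exists k => //; exists 1; rewrite ?mulg1 //.
  by split=> //; case/subgroupP: sU.
- by move=> _ [k Kk [v [_ Uv] <-]]; exists k => //; exists v.
Qed.

End TopologicalGroup.

Theorem theorem6 (G : topologicalGroupType)
    (haus : hausdorff_space G)
    (tdisc : totally_disconnected [set: G])
    (lcomp : locally_compact [set: G])
    (H : set G) :
  RIO_subgroup H -> RRS_subgroup H.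
Proof.
move=> [cH rio]; split=> // K oK kK.
have [F Fo KF] := rio _ oK kK.
have [/subgroupP[K1 KM _] KH /open_subspaceP[W oW]] := oK.
rewrite (setIidl KH) => WH.
have [sH _] := cH; have /subgroupP[_ HM HV] := sH.
have W1 : nbhs 1%g W.
  by apply: open_nbhs_nbhs; split=> //; move: K1; rewrite -WH => -[].
have [U [oU kU UW]] := van_dantzig haus tdisc lcomp W1.
have [O [oO KO OKU]] := bigcap_open_subgroup_sub Fo KF kK oU kU.
exists O => //; apply/seteqP; split=> [k Kk|x [Hx /OKU [k Kk [u Uu e]]]].
  by split; [exact: KH|exact: KO].
(* As [x] and [k] are in [H], so is [u]; since [U] was chosen inside [W], [u] lies in [W] ∩ [H],
   which is [K]. *)
rewrite -e; apply: KM => //; rewrite -WH; split; first exact: UW.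
rewrite (_ : u = k^-1 * x)%g; last by rewrite -e mulKg.
by apply: HM => //; apply: HV; exact: KH.
Qed.
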